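(* Suppose that $f:(0,a]\to(0,\infty)$ belongs to $\mathrm{RV}^0_\rho$ with $\rho\in[0,1]$, is nondecreasing and satisfies $\lim_{x\to0_+}f(x)=0$. Fix $\delta>0$, let $g(x):=\frac{1}{x f^-(1/x)}$ for $x\in[1/\delta,\infty)$ and let $\Phi_f(x):=\int_x^\delta\frac{1}{f^-(t)}\,dt$ for $x>0$. Then $g$ is locally bounded. Moreover: (i) If $\rho=0$ and $\ln(g)\in\mathrm{RV}_q$ with $q>0$, then for every $\alpha\in\mathbb{R}$, letting $\widehat g(x):=x^\alpha g(x)$, we have $\Phi_f^{-1}(s)\sim\frac{1}{\widehat g^{\leftarrow}(s)}$ as $s\to\infty$. (ii) If $\rho\in(0,1)$, then $\Phi_f^{-1}(s)\sim\frac{1}{g^{\leftarrow}((1/\rho-1)s)}$ as $s\to\infty$. (iii) Let $\rho=1$. If $f(t)\overset{c}{\sim}t$ as $t\to0_+$, then there exist $\tau_1,\tau_2>0$ and $0<c_1<c_2<1$ such that $\tau_1c_1^s\le\Phi_f^{-1}(s)\le\tau_2c_2^s$ whenever $s$ is large enough. If $t=o(f(t))$ as $t\to0_+$, then $\Phi_f^{-1}(s)=\frac{1}{o(g^{\leftarrow}(s))}$ as $s\to\infty$, i.e. $\frac{1}{\Phi_f^{-1}(s)\,g^{\leftarrow}(s)}\to0$ as $s\to\infty$.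
   Context: Generalized inverses: for $f:(0,a]\to(0,\infty)$ with $\lim_{x\to0_+}f(x)=0$, $f^-(y):=\sup\{x\in(0,a]\mid f(x)<y\}$, $y>0$. For $h:[b,\infty)\to\mathbb{R}$ with $h(x)\to\infty$ as $x\to\infty$, $h^{\leftarrow}(y):=\inf\{x\in[b,\infty)\mid h(x)>y\}$. $\Phi_f$ is continuous and decreasing on $(0,\infty)$ and $\Phi_f^{-1}$ is its usual inverse. A function is locally bounded if it is bounded on each compact subset of its domain. Regular variation: a measurable $f:[a,\infty)\to(0,\infty)$ ($a>0$) is in $\mathrm{RV}_\rho$, $\rho\in\mathbb{R}$, if $\lim_{x\to\infty}f(\lambda x)/f(x)=\lambda^\rho$ for all $\lambda>0$; a measurable $f:(0,a]\to(0,\infty)$ is in $\mathrm{RV}^0_\rho$ if $\lim_{x\to0_+}f(\lambda x)/f(x)=\lambda^\rho$ for all $\lambda>0$. Only behaviour near $\infty$ (resp. near $0$) matters: a function belongs to one of these classes if its restriction to some $[a,\infty)$ (resp. $(0,a]$) is positive and belongs to it. Asymptotic equivalence: $f\overset{c}{\sim}g$ means that there is a constant $\mu>0$ with $f(t)-\mu g(t)=o(g(t))$ in the indicated limit; $f\sim g$ means this holds with $\mu=1$. *)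

(* Defs.v *)
From HB Require Import structures.
From mathcomp Require Import all_boot all_order all_algebra.
From mathcomp Require Import all_classical all_reals all_analysis.
Set Implicit Arguments.
Unset Strict Implicit.
Unset Printing Implicit Defensive.
Import Order.TTheory GRing.Theory Num.Theory.
Import numFieldNormedType.Exports.
Local Open Scope classical_set_scope.
Local Open Scope ring_scope.

(* The Landau notations take a [filter_on]; the library has no such canonical
   structure for these two filters. *)
Canonical pinfty_filter_on (R : realType) :=
  FilterType (pinfty_nbhs R) _.
Canonical at_right_filter_on (R : realType) (x : R) :=
  FilterType (at_right x) _.

(* Functions with domain (0, a] or [b, +oo) are represented by total functions
   R -> R; the definitions below only use their values on that domain. *)

Definition ginv0 (R : realType) (a : R) (f : R -> R) (y : R) : R :=
  sup [set x | 0 < x <= a /\ f x < y].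

Definition ginvoo (R : realType) (b : R) (h : R -> R) (y : R) : R :=
  inf [set x | b <= x /\ y < h x].

Definition locally_bounded_on (R : realType) (D : set R) (h : R -> R) : Prop :=
  forall K : set R, compact K -> K `<=` D -> [bounded h x | x in K].

Definition RV0_on (R : realType) (a rho : R) (f : R -> R) : Prop :=
  [/\ 0 < a,
      forall x, 0 < x <= a -> 0 < f x,
      measurable_fun `]0, a] f &
      forall lambda, 0 < lambda ->
        f (lambda * x) / f x @[x --> 0^'+] --> lambda `^ rho].

Definition RV_on (R : realType) (b rho : R) (h : R -> R) : Prop :=
  [/\ 0 < b,
      forall x, b <= x -> 0 < h x,
      measurable_fun `[b, +oo[ h &
      forall lambda, 0 < lambda ->
        h (lambda * x) / h x @[x --> +oo] --> lambda `^ rho].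

Definition RV (R : realType) (rho : R) (h : R -> R) : Prop :=
  exists b, RV_on b rho h.

Definition oriented_integral (R : realType) (x y : R) (h : R -> R) : R :=
  if x <= y then \int[lebesgue_measure]_(t in `[x, y]) h t
  else - \int[lebesgue_measure]_(t in `[y, x]) h t.

(* Only meaningful for 0 < x. *)
Definition Phi (R : realType) (a delta : R) (f : R -> R) (x : R) : R :=
  oriented_integral x delta (fun t => 1 / ginv0 a f t).

(* Inverse of Phi as a function on (0, +oo); arguments outside the image of Phi
   get the default value 0. *)
Definition Phi_inv (R : realType) (a delta : R) (f : R -> R) : R -> R :=
  'pinv_(fun=> 0) `]0, +oo[%classic (Phi a delta f).

Definition equiv_upto_cst (R : realType) (F : filter_on R) (f g : R -> R) :
    Prop :=
  exists2 mu : R, 0 < mu & (fun t => f t - mu * g t) =o_F g.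

(* Main.v *)
Require Import Defs.
From HB Require Import structures.
From mathcomp Require Import all_boot all_order all_algebra.
From mathcomp Require Import all_classical all_reals all_analysis.
From mathcomp Require Import measurable_realfun ring lra.
Set Implicit Arguments.
Unset Strict Implicit.
Unset Printing Implicit Defensive.
Import Order.TTheory GRing.Theory Num.Theory.
Import numFieldNormedType.Exports.
Local Open Scope classical_set_scope.
Local Open Scope ring_scope.

(* Put G(x) = Phi(1/x). The substitution t = 1/u turns G into a primitive of
   g(u)/u, and u * g(u) = 1 / f^-(1/u) is nondecreasing, so that for x <= y
     g(x) (1 - x/y) <= G(y) - G(x) <= g(y) (y/x - 1).
   All asymptotics follow from these increment bounds and the growth of g along
   geometric progressions. Since 1 / Phi^-1(s) is the point where G takes the
   value s, the equivalence with 1 / h^<-(s) reduces to h(x) <= G(l x) and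
   G(x) <= h(l x) for every l > 1 and all large x.
   (i) ln(g(l x)) >= th ln(g(x)) with th > 1, so that ln g dominates ln, and
   the polynomial factors and constants are absorbed by the shift x -> l x.
   (ii) f^- inherits regular variation from f, and a discrete Karamata argument
   (A g - G, resp. G - A g, does not decrease along x -> mu x with mu close
   to 1) gives G ~ g / (1/rho - 1).
   (iii) If f ~c id then g is bounded away from 0 and infinity, so G is, up to
   additive constants, squeezed between multiples of ln. If t = o(f(t)) then g
   is slowly varying and tends to infinity, so that three dyadic increments of
   G below l x already exceed g(x), for every l > 0. *)

(** * Neighbourhoods of infinity and growth along geometric progressions *)

Lemma near_pinftyP (R : realType) (P : R -> Prop) :
  (\forall x \near +oo, P x) <-> exists2 x0, 0 < x0 & forall x, x0 <= x -> P x.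
Proof.
split=> [[M [_ HM]]|[x0 _ Hx0]].
  exists (Num.max 1 (M + 1)); first by rewrite lt_max ltr01.
  by move=> x; rewrite ge_max => /andP[_ Mx]; apply: HM; lra.
by near=> x; apply: Hx0; near: x; apply: nbhs_pinfty_ge; rewrite num_real.
Unshelve. all: by end_near. Qed.

Lemma near_pinfty_scale (R : realType) (P : R -> Prop) (l : R) :
  0 < l -> (\forall x \near +oo, P x) -> \forall x \near +oo, P (l * x).
Proof.
move=> l0 /near_pinftyP[x0 x00 Hx0]; apply/near_pinftyP.
exists (x0 / l); first exact: divr_gt0.
by move=> x; rewrite ler_pdivrMr // mulrC => /Hx0.
Qed.

Lemma ln_near_pinfty (R : realType) (c C : R) :
  0 < c -> \forall x \near +oo, C <= c * ln x.
Proof.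
move=> c0; apply/near_pinftyP; exists (expR (C / c)); first exact: expR_gt0.
move=> x Hx; rewrite mulrC -ler_pdivrMr // -[leLHS]expRK ler_ln ?posrE //.
  exact: expR_gt0.
exact: lt_le_trans (expR_gt0 _) Hx.
Qed.

(** Dividing by [mu] finitely often brings any [x] back to [[x0, mu * x0]], and no division
    increases [H]. *)
Lemma ge_of_step (R : realType) (H : R -> R) (x0 mu m : R) :
  0 < x0 -> 1 < mu ->
  (forall x, x0 <= x -> H x <= H (mu * x)) ->
  (forall x, x0 <= x <= mu * x0 -> m <= H x) ->
  forall x, x0 <= x -> m <= H x.
Proof.
move=> x00 mu1 Hs Hm.
have mu0 : 0 < mu by apply: lt_trans mu1.
have ind n : forall x, x0 <= x <= mu ^+ n.+1 * x0 -> m <= H x.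
  elim: n => [|n IHn] x /andP[x0x xn]; first by apply: Hm; rewrite x0x.
  have [xmu|xmu] := leP x (mu * x0); first by apply: Hm; rewrite x0x.
  have -> : x = mu * (x / mu) by field; apply: lt0r_neq0.
  have x0xmu : x0 <= x / mu by rewrite ler_pdivlMr // mulrC ltW.
  apply: le_trans (Hs _ x0xmu); apply: IHn.
  by rewrite x0xmu /= ler_pdivrMr // mulrAC -exprSr.
move=> x x0x; pose d := mu - 1.
have d0 : 0 < d by rewrite subr_gt0.
have [n Hn] : exists n : nat, x / x0 / d <= n%:R.
  by exists (Num.truncn (x / x0 / d)).+1; apply/ltW/truncnS_gt.
apply: (ind n); rewrite x0x /= -ler_pdivrMr //.
rewrite ler_pdivrMr // in Hn; apply: le_trans Hn _.
(* Bernoulli's inequality: the windows of the induction exhaust the half-line. *)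
have Bern k : 1 + k%:R * d <= mu ^+ k.
  elim: k => [|k IHk]; first by rewrite mul0r addr0.
  rewrite exprS -natr1.
  apply: le_trans (ler_wpM2l (ltW mu0) IHk).
  have : 0 <= k%:R * d * d by rewrite !mulr_ge0 // ltW.
  by rewrite /d; lra.
have := Bern n.+1; rewrite -natr1 mulrDl => Hb.
by apply: le_trans Hb; lra.
Qed.

(** With [c = d / ln mu], the function [H - c * ln] does not decrease along [x -> mu * x]. The sign
    of [d] is free: upper bounds on [G] come from [H = - G] and a negative [d]. *)
Lemma log_growth (R : realType) (H : R -> R) (x0 mu m d : R) :
  0 < x0 -> 1 < mu ->
  (forall x, x0 <= x -> H x + d <= H (mu * x)) ->
  (forall x, x0 <= x <= mu * x0 -> m <= H x) ->
  exists C, forall x, x0 <= x -> d / ln mu * ln x - C <= H x.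
Proof.
move=> x00 mu1 Hs Hm.
have mu0 : 0 < mu by apply: lt_trans mu1.
have lmu : 0 < ln mu by rewrite ln_gt0.
pose c := d / ln mu.
pose M := `|c| * (`|ln x0| + `|ln (mu * x0)|).
exists (M - m) => x x0x.
suff : m - M <= H x - c * ln x by rewrite /c; lra.
move: x x0x; apply: (@ge_of_step _ (fun x => H x - c * ln x) _ mu) => // x.
  move=> x0x; have x0' : 0 < x by apply: lt_le_trans x0x.
  have -> : ln (mu * x) = ln mu + ln x by rewrite lnM.
  have -> : c * (ln mu + ln x) = d + c * ln x.
    by rewrite /c; field; apply: lt0r_neq0.
  by have := Hs _ x0x; lra.
move=> /andP[x0x xmu]; have x0' : 0 < x by apply: lt_le_trans x0x.
have Hmx : m <= H x by apply: Hm; rewrite x0x.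
suff : c * ln x <= M by lra.
apply: le_trans (ler_norm _) _; rewrite normrM /M ler_wpM2l //.
have l1 : ln x0 <= ln x by rewrite ler_ln.
have l2 : ln x <= ln (mu * x0) by rewrite ler_ln // posrE mulr_gt0.
rewrite ler_norml; apply/andP; split.
  have := ler_norm (- ln x0); rewrite normrN.
  have := normr_ge0 (ln (mu * x0)); lra.
have := ler_norm (ln (mu * x0)); have := normr_ge0 (ln x0); lra.
Qed.

(** * Primitives with respect to [du / u] *)

(* Stands for G(x) = \int_b^x g(u)/u du with u * g(u) nondecreasing; these
   increment bounds are all that is used of the integral. *)
Definition log_primitive (R : realType) (g G : R -> R) : Prop :=
  [/\ forall x, 0 < x -> 0 < g x,
      forall x y, 0 < x -> x <= y -> x * g x <= y * g y &
      forall x y, 0 < x -> x <= y ->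
        g x * (1 - x / y) <= G y - G x <= g y * (y / x - 1)].

Lemma log_primitive_lt (R : realType) (g G : R -> R) (x y : R) :
  log_primitive g G -> 0 < x -> x < y -> G x < G y.
Proof.
move=> [g0 _ HG] x0 xy; have y0 : 0 < y by apply: lt_trans xy.
have /andP[+ _] := HG x y x0 (ltW xy); rewrite -subr_gt0 => ?.
suff : 0 < g x * (1 - x / y) by lra.
by rewrite mulr_gt0 ?g0 // subr_gt0 ltr_pdivrMr ?mul1r.
Qed.

Lemma log_primitive_le (R : realType) (g G : R -> R) (x y : R) :
  log_primitive g G -> 0 < x -> x <= y -> G x <= G y.
Proof.
move=> gG x0; rewrite le_eqVlt => /predU1P[->//|xy].
exact/ltW/(log_primitive_lt gG).
Qed.

Lemma log_primitive_lt_inv (R : realType) (g G : R -> R) (x y : R) :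
  log_primitive g G -> 0 < y -> G x < G y -> x < y.
Proof.
move=> gG y0; apply: contraTT; rewrite -!leNgt => yx.
exact: log_primitive_le gG _ _.
Qed.

Lemma log_primitive_step (R : realType) (g G : R -> R) (mu x : R) :
  log_primitive g G -> 1 < mu -> 0 < x ->
  (1 - mu^-1) * g x <= G (mu * x) - G x <= (mu - 1) * g (mu * x).
Proof.
move=> [_ _ HG] mu1 x0; have mu0 : 0 < mu by apply: lt_trans mu1.
have := HG x (mu * x) x0; rewrite ler_peMl ?(ltW mu1) ?(ltW x0) // => /(_ isT).
have -> : x / (mu * x) = mu^-1 by field; rewrite !lt0r_neq0.
by rewrite mulfK ?lt0r_neq0 // ![g _ * _]mulrC.
Qed.

Lemma log_primitive_continuous (R : realType) (g G : R -> R) (x : R) :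
  log_primitive g G -> 0 < x -> {for x, continuous G}.
Proof.
move=> gG x0; have [g0 kg HG] := gG.
have x20 : 0 < x / 2 by lra.
(* For [u <= v] in [[x / 2, 2 * x]], [v * g v] is at most [2 * x * g (2 * x)] and [v * u] at least
   [(x / 2) ^+ 2], so [L] is a Lipschitz constant of [G] there. *)
pose L := (2 * x * g (2 * x)) / (x / 2) ^+ 2.
have L0 : 0 < L by rewrite divr_gt0 ?exprn_gt0 ?mulr_gt0 ?g0 ?mulr_gt0 //; lra.
have Lip u v : x / 2 <= u -> u <= v -> v <= 2 * x -> G v - G u <= L * (v - u).
  move=> xu uv vx; have u0 : 0 < u by lra.
  have v0 : 0 < v by lra.
  have /andP[_ Guv] := HG u v u0 uv; apply: le_trans Guv _.
  have -> : g v * (v / u - 1) = (v * g v) * (v - u) / (v * u).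
    by field; rewrite !lt0r_neq0.
  rewrite /L -mulrA -[leRHS]mulrA ler_pM //.
  - by rewrite mulr_ge0 // ltW // g0.
  - by rewrite mulr_ge0 ?invr_ge0 ?mulr_ge0 //; lra.
  - exact: kg.
  rewrite mulrC ler_wpM2r ?subr_ge0 // lef_pV2 ?posrE ?mulr_gt0 ?exprn_gt0 //.
  by rewrite expr2 ler_pM //; lra.
have absLip v : x / 2 <= v <= 2 * x -> `|G x - G v| <= L * `|x - v|.
  move=> /andP[v1 v2]; have v0 : 0 < v by lra.
  have [xv|vx] := leP x v.
    rewrite distrC [`|x - v|]distrC !ger0_norm ?subr_ge0 //.
      by apply: Lip => //; lra.
    exact: log_primitive_le gG _ _.
  rewrite !ger0_norm ?subr_ge0 ?(ltW vx) //.
    by apply: Lip => //; [exact: ltW|lra].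
  exact: log_primitive_le gG _ (ltW vx).
apply/cvgrPdist_le => e e0; near=> v.
apply: le_trans (absLip v _) _.
  have : `|x - v| <= x / 2.
    by near: v; apply: cvgr_dist_le => //; lra.
  by rewrite ler_norml; lra.
rewrite mulrC -ler_pdivlMr //; near: v; apply: cvgr_dist_le => //.
exact: divr_gt0.
Unshelve. all: by end_near. Qed.

Lemma log_primitive_IVT (R : realType) (g G : R -> R) (x y s : R) :
  log_primitive g G -> 0 < x -> x <= y -> G x <= s <= G y ->
  exists2 z, 0 < z & G z = s.
Proof.
move=> gG x0 xy Hs.
have Gxy : G x <= G y by apply: log_primitive_le gG _ _.
have [||z] := @IVT _ G x y s xy.
- apply: continuous_in_subspaceT => z; rewrite inE /= in_itv /= => /andP[xz _].
  by apply: log_primitive_continuous gG _; apply: lt_le_trans xz.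
- by rewrite min_l // max_r.
rewrite in_itv /= => /andP[xz _] Gz; exists z => //.
exact: lt_le_trans xz.
Qed.

(** Each doubling of [x] adds at least [m / 2] to [G]. *)
Lemma log_primitive_dvg (R : realType) (g G : R -> R) (m : R) :
  log_primitive g G -> 0 < m -> (\forall x \near +oo, m <= g x) ->
  exists2 c, 0 < c & exists C, \forall x \near +oo, c * ln x - C <= G x.
Proof.
move=> gG m0 /near_pinftyP[x0 x00 Hx0].
have two1 : 1 < 2 :> R by lra.
have [x x0x|x /andP[x0x _]|C HC] :=
  @log_growth _ G x0 2 (G x0) (m / 2) x00 two1.
- have x0' : 0 < x by apply: lt_le_trans x0x.
  have /andP[+ _] := log_primitive_step gG two1 x0'.
  by have := Hx0 _ x0x; lra.
- exact: log_primitive_le gG _ _.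
exists (m / 2 / ln 2); first by rewrite !divr_gt0 // ln_gt0 //; lra.
by exists C; apply/near_pinftyP; exists x0.
Qed.

Lemma log_primitive_cvgy (R : realType) (g G : R -> R) (m : R) :
  log_primitive g G -> 0 < m -> (\forall x \near +oo, m <= g x) ->
  forall K, \forall x \near +oo, K <= G x.
Proof.
move=> gG m0 gm K; have [c c0 [C HC]] := log_primitive_dvg gG m0 gm.
near=> x; apply: le_trans (_ : c * ln x - C <= _); last by near: x.
by rewrite lerBrDr; near: x; apply: ln_near_pinfty.
Unshelve. all: by end_near. Qed.

(** * Generalized inverses at infinity compared with the inverse of [G] *)

(** Since [G] is monotone, [G (y s) = s > G x0] forces [y s > x0]; thus [y s] tends to infinity. *)
Lemma inverse_near (R : realType) (g G y : R -> R) :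
  log_primitive g G -> (\forall s \near +oo, 0 < y s /\ G (y s) = s) ->
  forall P : R -> Prop,
    (\forall x \near +oo, P x) -> \forall s \near +oo, P (y s).
Proof.
move=> gG Hy P /near_pinftyP[x0 x00 Px0]; near=> s; apply: Px0.
have [y0 Gy] : 0 < y s /\ G (y s) = s by near: s.
apply/ltW/(log_primitive_lt_inv gG y0); rewrite Gy.
by near: s; apply: nbhs_pinfty_gt; rewrite num_real.
Unshelve. all: by end_near. Qed.

Lemma ginvoo_lbound (R : realType) (b : R) (h : R -> R) (s x : R) :
  b <= x -> s < h x -> ginvoo b h s <= x.
Proof. by move=> bx sx; apply: ge_inf => //; exists b => z []. Qed.

(** The witness [x0] excludes the empty set, whose infimum is 0 by convention. *)
Lemma ginvoo_ge (R : realType) (b : R) (h : R -> R) (s c x0 : R) :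
  b <= x0 -> s < h x0 -> (forall x, b <= x -> s < h x -> c <= x) ->
  c <= ginvoo b h s.
Proof.
move=> bx0 sx0 Hc; apply: lb_le_inf; first by exists x0.
by move=> x [bx sx]; apply: Hc.
Qed.

(** Once [s] exceeds the bound of [h] on [[b, x0]], every [x] with [s < h x] lies beyond [x0], and
    [G (y s) = s < G (l * x)] gives [y s < l * x]. *)
Lemma le_ginvoo (R : realType) (g G h y : R -> R) (b l : R) :
  log_primitive g G -> 0 < b -> 0 < l ->
  (\forall s \near +oo, 0 < y s /\ G (y s) = s) ->
  (forall X, exists M, forall x, b <= x <= X -> h x <= M) ->
  (\forall s \near +oo, exists2 x, b <= x & s < h x) ->
  (\forall x \near +oo, h x <= G (l * x)) ->
  \forall s \near +oo, y s / l <= ginvoo b h s.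
Proof.
move=> gG b0 l0 Hy hbd Hne /near_pinftyP[x0 x00 Hx0].
have [M HM] := hbd x0; near=> s.
have [x bx sx] : exists2 x, b <= x & s < h x by near: s.
apply: (ginvoo_ge bx sx) => {sx}x {}bx sx.
have [y0 Gy] : 0 < y s /\ G (y s) = s by near: s.
have x0' : 0 < x by apply: lt_le_trans bx.
have Ms : M < s by near: s; apply: nbhs_pinfty_gt; rewrite num_real.
have [xx0|x0x] := leP x x0.
  by have := HM x; rewrite bx xx0 => /(_ isT) ?; lra.
have := Hx0 _ (ltW x0x) => hG; rewrite ler_pdivrMr // mulrC; apply/ltW.
by apply: (log_primitive_lt_inv gG); rewrite ?mulr_gt0 // Gy; lra.
Unshelve. all: by end_near. Qed.

(** The point [l' * y s] itself belongs to the set defining [ginvoo]: [G (y s) < G (l' / l * y s) <=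
    h (l' * y s)], where the gap between [l] and [l'] provides the strict inequality. *)
Lemma ginvoo_le (R : realType) (g G h y : R -> R) (b l l' : R) :
  log_primitive g G -> 0 < l < l' ->
  (\forall s \near +oo, 0 < y s /\ G (y s) = s) ->
  (\forall x \near +oo, G x <= h (l * x)) ->
  \forall s \near +oo, ginvoo b h s <= l' * y s /\
    exists2 x, b <= x & s < h x.
Proof.
move=> gG /andP[l0 ll'] Hy HGh; have l'0 : 0 < l' by apply: lt_trans ll'.
have b_lt : \forall s \near +oo, b < l' * s.
  apply: (near_pinfty_scale (P := fun z => b < z)) => //.
  by apply: nbhs_pinfty_gt; rewrite num_real.
have HGh' : \forall x \near +oo, G (l' / l * x) <= h (l * (l' / l * x)).
  exact: (near_pinfty_scale (divr_gt0 l'0 l0) HGh).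
near=> s.
have [y0 Gy] : 0 < y s /\ G (y s) = s by near: s.
have by_ : b < l' * y s by near: s; apply: (inverse_near gG Hy b_lt).
have sh : s < h (l' * y s).
  have : G (l' / l * y s) <= h (l * (l' / l * y s)).
    by near: s; apply: (inverse_near gG Hy HGh').
  rewrite mulrA [l * _]mulrC divfK ?lt0r_neq0 //; apply: lt_le_trans.
  rewrite -{1}Gy; apply: (log_primitive_lt gG) => //.
  by rewrite ltr_pMl // ltr_pdivlMr // mul1r.
split; last by exists (l' * y s) => //; exact: ltW.
by apply: ginvoo_lbound => //; exact: ltW.
Unshelve. all: by end_near. Qed.

Lemma inv_dist_le (R : realType) (w y l e : R) :
  0 < y -> 1 < l <= 1 + e -> y / l <= w -> w <= l * y ->
  `|y^-1 - 1 / w| <= e * `|1 / w|.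
Proof.
move=> y0 /andP[l1 le] yw wy; have l0 : 0 < l by lra.
have w0 : 0 < w by apply: lt_le_trans yw; apply: divr_gt0.
have -> : y^-1 - 1 / w = (w - y) / y * (1 / w) by field; rewrite !lt0r_neq0.
rewrite normrM ler_wpM2r // ler_norml ler_pdivlMr // ler_pdivrMr //.
rewrite ler_pdivrMr // in yw.
have wy2 : w * l <= w * (1 + e) by rewrite ler_wpM2l // ltW.
have yl : l * y <= (1 + e) * y by rewrite ler_wpM2r // ltW.
apply/andP; split; last by lra.
have [e1|e1] := leP 1 e.
  have : y <= e * y by rewrite ler_peMl // ltW.
  by lra.
have : y * (1 - e) <= w * (1 + e) * (1 - e) by rewrite ler_wpM2r //; lra.
have : 0 <= w * e * e by rewrite !mulr_ge0 //; lra.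
lra.
Qed.

(* Applied with [p := Phi_inv], whose reciprocal inverts [G]. *)
Lemma ginvoo_equiv (R : realType) (g G h p : R -> R) (b : R) :
  log_primitive g G -> 0 < b ->
  (\forall s \near +oo, 0 < (p s)^-1 /\ G (p s)^-1 = s) ->
  (forall X, exists M, forall x, b <= x <= X -> h x <= M) ->
  (forall l, 1 < l -> \forall x \near +oo, h x <= G (l * x)) ->
  (forall l, 1 < l -> \forall x \near +oo, G x <= h (l * x)) ->
  p ~_(pinfty_nbhs R) (fun s => 1 / ginvoo b h s).
Proof.
move=> gG b0 Hy hbd hG Gh; apply/eqaddoP => e e0.
pose y s := (p s)^-1.
pose l := 1 + Num.min e 1 / 2.
have me : 0 < Num.min e 1 by rewrite lt_min e0 ltr01.
have me1 : Num.min e 1 <= 1 by rewrite ge_min lexx orbT.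
have mee : Num.min e 1 <= e by rewrite ge_min lexx.
have l1 : 1 < l by rewrite /l; lra.
have l0 : 0 < l by lra.
(* Strictly between 1 and [l], as [ginvoo_le] asks for a gap. *)
pose l' := 1 + Num.min e 1 / 4.
have l'1 : 1 < l' by rewrite /l'; lra.
have l'l : 0 < l' < l by rewrite /l /l'; apply/andP; split; lra.
have up := @ginvoo_le _ g G h y b l' l gG l'l Hy
  (Gh l' l'1).
have lo : \forall s \near +oo, y s / l <= ginvoo b h s.
  apply: (le_ginvoo gG b0 l0 Hy hbd); last exact: hG.
  by apply: filterS up => s [].
near=> s.
have [y0 Gy] : 0 < y s /\ G (y s) = s by near: s.
have [wy _] : ginvoo b h s <= l * y s /\ exists2 x, b <= x & s < h x.
  by near: s.
have yw : y s / l <= ginvoo b h s by near: s.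
suff : `|(y s)^-1 - 1 / ginvoo b h s| <= e * `|1 / ginvoo b h s|.
  by rewrite /y invrK.
by apply: (inv_dist_le y0 _ yw wy); rewrite /l; lra.
Unshelve. all: by end_near. Qed.

(** * The generalized inverse of [f] near 0 *)

Definition nd_vanishing (R : realType) (a : R) (f : R -> R) : Prop :=
  [/\ 0 < a, forall x, 0 < x <= a -> 0 < f x,
      forall x y, 0 < x -> x <= y -> y <= a -> f x <= f y &
      f x @[x --> 0^'+] --> 0].

Lemma near_at_right0P (R : realType) (P : R -> Prop) :
  (\forall x \near 0^'+, P x) <->
  exists2 d, 0 < d & forall x : R, 0 < x < d -> P x.
Proof.
split=> [[e /= e0 He]|[d d0 Hd]].
  exists e => // x /andP[x0 xe]; apply: He => //=.
  by rewrite sub0r normrN gtr0_norm.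
near=> x; apply: Hd; apply/andP; split; near: x.
  exact: nbhs_right_gt.
exact: nbhs_right_lt.
Unshelve. all: by end_near. Qed.

Lemma ginv0_le (R : realType) (a : R) (f : R -> R) (x y : R) :
  nd_vanishing a f -> 0 < x <= a -> y <= f x -> ginv0 a f y <= x.
Proof.
move=> [a0 f0 fnd _] /andP[x0 xa] yfx.
(* An empty set has the default supremum 0, which is below [x]. *)
have [S0|/set0P S0] := eqVneq [set x | 0 < x <= a /\ f x < y] set0.
  by rewrite /ginv0 S0 sup0 ltW.
apply: ge_sup => // z [/andP[z0 za] fz]; rewrite leNgt; apply/negP => xz.
by have := fnd x z x0 (ltW xz) za; lra.
Qed.

Lemma le_ginv0 (R : realType) (a : R) (f : R -> R) (x y : R) :
  0 < x <= a -> f x < y -> x <= ginv0 a f y.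
Proof.
move=> xa fx; apply: ub_le_sup => //.
by exists a => z [/andP[]].
Qed.

Lemma ginv0_gt0 (R : realType) (a : R) (f : R -> R) (y : R) :
  nd_vanishing a f -> 0 < y -> 0 < ginv0 a f y.
Proof.
move=> [a0 f0 fnd fl] y0.
have /near_at_right0P[d d0 Hd] : \forall x \near 0^'+, f x < y.
  exact: (cvgr_lt 0).
pose x := Num.min (d / 2) a.
have x0 : 0 < x by rewrite /x lt_min; apply/andP; split => //; lra.
apply: (lt_le_trans x0); apply: le_ginv0.
  by rewrite x0 /= /x ge_min lexx orbT.
by apply: Hd; rewrite x0 /= /x gt_min; apply/orP; left; lra.
Qed.

Lemma ginv0_nd (R : realType) (a : R) (f : R -> R) (y y' : R) :
  nd_vanishing a f -> y <= y' -> ginv0 a f y <= ginv0 a f y'.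
Proof.
move=> [a0 f0 fnd fl] yy'.
have [S0|/set0P S0] := eqVneq [set x | 0 < x <= a /\ f x < y] set0.
  rewrite /ginv0 S0 sup0.
  have [->|/set0P[x Sx]] := eqVneq [set x | 0 < x <= a /\ f x < y'] set0.
    by rewrite sup0.
  case: (Sx) => /andP[/ltW x0 _] _; apply: le_trans x0 _.
  by apply: ub_le_sup => //; exists a => z [/andP[]].
apply: ge_sup => // x [xa fx]; apply: le_ginv0 => //.
exact: lt_le_trans yy'.
Qed.

Lemma f_lt_ginv0 (R : realType) (a : R) (f : R -> R) (x y : R) :
  nd_vanishing a f -> 0 < y -> 0 < x < ginv0 a f y -> f x < y.
Proof.
move=> af y0 /andP[x0 xF]; have [a0 f0 fnd fl] := af.
rewrite ltNge; apply/negP => yfx.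
have [xa|ax] := leP x a.
  have : ginv0 a f y <= x by apply: ginv0_le => //; rewrite x0.
  by lra.
have : ginv0 a f y <= a.
  have [S0|/set0P S0] := eqVneq [set x | 0 < x <= a /\ f x < y] set0.
    by rewrite /ginv0 S0 sup0 ltW.
  by apply: ge_sup => // z [/andP[]].
lra.
Qed.

Lemma le_f_ginv0 (R : realType) (a : R) (f : R -> R) (x y : R) :
  0 < x <= a -> ginv0 a f y < x -> y <= f x.
Proof.
move=> xa Fx; rewrite leNgt; apply/negP => /(le_ginv0 xa).
by lra.
Qed.

Lemma ginv0_small (R : realType) (a : R) (f : R -> R) (e : R) :
  nd_vanishing a f -> 0 < e -> \forall x \near +oo, ginv0 a f x^-1 <= e.
Proof.
move=> af e0; have [a0 f0 _ _] := af; pose z := Num.min e a.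
have z0 : 0 < z <= a by rewrite /z lt_min e0 a0 /= ge_min lexx orbT.
apply/near_pinftyP; exists (f z)^-1; first by rewrite invr_gt0 f0.
move=> x zx; apply: (@le_trans _ _ z); last by rewrite /z ge_min lexx.
apply: ginv0_le => //; rewrite invf_ple ?posrE ?f0 //.
by apply: lt_le_trans zx; rewrite invr_gt0 f0.
Qed.

(* Both comparisons trade the strict gap between [nu] and [nu'] for the
   possible jump of [f] at [ginv0 a f y]. *)
Lemma ginv0_scale_le (R : realType) (a rho : R) (f : R -> R) (l nu nu' : R) :
  nd_vanishing a f -> RV0_on a rho f -> 0 < nu' < nu -> l < nu' `^ rho ->
  \forall x \near +oo, ginv0 a f (l * x^-1) <= nu * ginv0 a f x^-1.
Proof.
move=> af [_ f0 _ frv] /andP[nu'0 nu'nu] lnu; have nu0 : 0 < nu by lra.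
(* With [F] the value of [ginv0] at [x^-1], the point [k * F] lies just above [F], where [f] has
   already reached [x^-1]. *)
have [a0 _ _ _] := af; pose k := nu / nu'.
have k1 : 1 < k by rewrite /k ltr_pdivlMr // mul1r.
have k0 : 0 < k by lra.
have /near_at_right0P[d d0 Hd] : \forall z \near 0^'+, l < f (nu' * z) / f z.
  by apply: (cvgr_gt (nu' `^ rho)); first exact: frv.
(* The three bounds on [F] ensure [k * F < d], [k * F <= a] and [nu * F <= a]. *)
pose e := Num.min (Num.min (d / (2 * k)) (a / k)) (a / nu).
have e0 : 0 < e by rewrite /e !lt_min !divr_gt0 // mulr_gt0.
near=> x; have x0 : 0 < x.
  by near: x; apply: nbhs_pinfty_gt; rewrite num_real.
have F0 : 0 < ginv0 a f x^-1 by rewrite ginv0_gt0 ?invr_gt0.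
have : ginv0 a f x^-1 <= e by near: x; apply: ginv0_small.
move: F0; set F := ginv0 a f x^-1 => F0.
rewrite /e !le_min => /andP[/andP[Fd Fa] Fa'].
rewrite ler_pdivlMr // mulrC in Fa.
rewrite ler_pdivlMr // mulrC in Fa'.
have k20 : 0 < 2 * k by lra.
rewrite ler_pdivlMr // in Fd.
have kF0 : 0 < k * F by exact: mulr_gt0.
have FkF : F < k * F by rewrite ltr_pMl.
apply: ginv0_le => //; first by rewrite mulr_gt0.
have xf : x^-1 <= f (k * F) by apply: (@le_f_ginv0 _ a); rewrite ?kF0.
have fk0 : 0 < f (k * F) by rewrite f0 // kF0.
have := Hd (k * F); rewrite kF0 /= ltr_pdivlMr // => lf.
have [l0|l0] := leP l 0.
  apply: (@le_trans _ _ 0); first by rewrite mulr_le0_ge0 // invr_ge0 ltW.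
  by apply/ltW/f0; rewrite mulr_gt0.
have -> : nu * F = nu' * (k * F) by rewrite /k; field; rewrite lt0r_neq0.
have lf' : l * f (k * F) < f (nu' * (k * F)) by apply: lf; lra.
by apply: (le_trans _ (ltW lf')); rewrite ler_wpM2l // ltW.
Unshelve. all: by end_near. Qed.

Lemma ginv0_scale_ge (R : realType) (a rho : R) (f : R -> R) (l nu nu' : R) :
  nd_vanishing a f -> RV0_on a rho f -> 0 < nu < nu' -> nu' `^ rho < l ->
  \forall x \near +oo, nu * ginv0 a f x^-1 <= ginv0 a f (l * x^-1).
Proof.
move=> af [_ f0 _ frv] /andP[nu0 nu'nu] lnu; have nu'0 : 0 < nu' by lra.
(* Now [k < 1]: just below [F], [f] is still under [x^-1]. *)
have [a0 _ _ _] := af; pose k := nu / nu'.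
have k1 : k < 1 by rewrite /k ltr_pdivrMr // mul1r.
have k0 : 0 < k by rewrite divr_gt0.
have l0 : 0 < l by apply: le_lt_trans lnu; exact: powR_ge0.
have /near_at_right0P[d d0 Hd] : \forall z \near 0^'+, f (nu' * z) / f z < l.
  by apply: (cvgr_lt (nu' `^ rho)); first exact: frv.
pose e := Num.min (Num.min (d / 2) a) (a / nu).
have e0 : 0 < e by rewrite /e !lt_min !divr_gt0 // a0.
near=> x; have x0 : 0 < x.
  by near: x; apply: nbhs_pinfty_gt; rewrite num_real.
have F0 : 0 < ginv0 a f x^-1 by rewrite ginv0_gt0 ?invr_gt0.
have : ginv0 a f x^-1 <= e by near: x; apply: ginv0_small.
move: F0; set F := ginv0 a f x^-1 => F0.
rewrite /e !le_min => /andP[/andP[Fd Fa] Fa'].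
rewrite ler_pdivlMr // mulrC in Fa'.
have kF0 : 0 < k * F by exact: mulr_gt0.
have FkF : k * F < F by rewrite gtr_pMl.
apply: le_ginv0; first by rewrite mulr_gt0.
have xf : f (k * F) < x^-1.
  by apply: (f_lt_ginv0 af); rewrite ?invr_gt0 // kF0.
have fk0 : 0 < f (k * F) by rewrite f0 // kF0; lra.
have -> : nu * F = nu' * (k * F) by rewrite /k; field; rewrite lt0r_neq0.
have := Hd (k * F); rewrite kF0 /= ltr_pdivrMr // => lf.
have lf' : f (nu' * (k * F)) < l * f (k * F) by apply: lf; lra.
by apply: lt_trans lf' _; rewrite ltr_pM2l.
Unshelve. all: by end_near. Qed.

(** * The integral [Phi] and its inverse *)

Lemma integrable_ginv0V (R : realType) (a : R) (f : R -> R) (x y : R) :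
  nd_vanishing a f -> 0 < x ->
  lebesgue_measure.-integrable `[x, y] (EFin \o (fun t => 1 / ginv0 a f t)).
Proof.
move=> af x0; apply: measurable_bounded_integrable => //.
- by rewrite /= lebesgue_measure_itv /=; case: ifP => _;
  rewrite ?ltry // -EFinB ltry.
(* Truncating [t] from below at [x] gives a function that is nonincreasing on the whole line and
   agrees with the integrand on [[x, y]]. *)
- pose k t := 1 / ginv0 a f (Num.max x t).
  have kP t : 0 < Num.max x t by rewrite lt_max x0.
  apply: (@eq_measurable_fun _ _ _ _ _ k) => [t|].
    by rewrite inE /= in_itv /= /k => /andP[xt _]; rewrite max_r.
  apply: nonincreasing_measurable => // s t st.
  rewrite /k !div1r lef_pV2 ?posrE ?ginv0_gt0 //.
  by apply: ginv0_nd => //; rewrite ge_max !le_max lexx st orbT.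
exists (1 / ginv0 a f x); split; rewrite ?num_real // => K FK t /=.
rewrite in_itv /= => /andP[xt _]; apply: le_trans (ltW FK).
have t0 : 0 < t by apply: lt_le_trans xt.
rewrite !div1r ger0_norm; last by rewrite invr_ge0 ltW // ginv0_gt0.
by rewrite lef_pV2 ?posrE ?ginv0_gt0 // ginv0_nd.
Qed.

Lemma Rintegral_ginv0V_bounds (R : realType) (a : R) (f : R -> R) (x y : R) :
  nd_vanishing a f -> 0 < x -> x <= y ->
  (y - x) / ginv0 a f y <=
    \int[lebesgue_measure]_(t in `[x, y]) (1 / ginv0 a f t) <=
    (y - x) / ginv0 a f x.
Proof.
move=> af x0 xy; have y0 : 0 < y by apply: lt_le_trans xy.
have cst r : \int[lebesgue_measure]_(t in `[x, y]) r = (y - x) * r.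
  rewrite Rintegral_cst //= lebesgue_measure_itv /= mulrC.
  move: xy; rewrite le_eqVlt => /predU1P[->|xy].
    by rewrite ltxx subrr mul0r.
  by rewrite lte_fin xy -EFinB.
have icst (r : R) : lebesgue_measure.-integrable `[x, y] (EFin \o (fun=> r)).
  apply: measurable_bounded_integrable => //.
  - by rewrite /= lebesgue_measure_itv /=; case: ifP => _;
  rewrite ?ltry // -EFinB ltry.
  - exact: bounded_cst.
rewrite -!cst; apply/andP; split; apply: le_Rintegral => //;
  try exact: integrable_ginv0V; try exact: icst;
  move=> t; rewrite /= in_itv /= => /andP[xt ty];
  (have t0 : 0 < t by apply: lt_le_trans xt);
  by rewrite div1r lef_pV2 ?posrE ?ginv0_gt0 // ginv0_nd.
Qed.

Lemma Rintegral_ginv0VD (R : realType) (a : R) (f : R -> R) (x y z : R) :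
  nd_vanishing a f -> 0 < x -> x <= y -> y <= z ->
  \int[lebesgue_measure]_(t in `[x, z]) (1 / ginv0 a f t) =
  \int[lebesgue_measure]_(t in `[x, y]) (1 / ginv0 a f t) +
  \int[lebesgue_measure]_(t in `[y, z]) (1 / ginv0 a f t).
Proof.
move=> af x0 xy yz; have y0 : 0 < y by apply: lt_le_trans xy.
have Iyz : lebesgue_measure.-integrable `]y, z]
    (EFin \o (fun t => 1 / ginv0 a f t)).
  apply: (integrableS _ _ _ (integrable_ginv0V z af y0)) => //.
  by apply: subset_itvr; rewrite bnd_simp.
rewrite -(Rintegral_itv_obnd_cbnd Iyz).
rewrite -(Rintegral_itvB (integrable_ginv0V z af x0)) ?bnd_simp //.
by rewrite addrC subrK.
Qed.

Lemma PhiB (R : realType) (a delta : R) (f : R -> R) (x y : R) :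
  nd_vanishing a f -> 0 < delta -> 0 < x -> x <= y ->
  Phi a delta f x - Phi a delta f y =
  \int[lebesgue_measure]_(t in `[x, y]) (1 / ginv0 a f t).
Proof.
move=> af d0 x0 xy; rewrite /Phi /oriented_integral.
have [yd|dy] := leP y delta.
  rewrite (le_trans xy yd) (Rintegral_ginv0VD af x0 xy yd).
  by rewrite addrK.
have [xd|dx] := leP x delta.
  by rewrite opprK (Rintegral_ginv0VD af x0 xd (ltW dy)).
rewrite opprK (Rintegral_ginv0VD af d0 (ltW dx) xy).
by rewrite addrA addNr add0r.
Qed.

(** The endpoint bounds for the integral of [1 / f^-] over [[1/y, 1/x]] are the increment bounds,
    because [(1/x - 1/y) / f^-(1/x) = g(x) * (1 - x/y)], and likewise at [y]. *)
Lemma log_primitive_Phi (R : realType) (a delta : R) (f : R -> R) :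
  nd_vanishing a f -> 0 < delta ->
  log_primitive (fun x => 1 / (x * ginv0 a f (1 / x)))
    (fun x => Phi a delta f x^-1).
Proof.
move=> af d0.
have F0 (x : R) : 0 < x -> 0 < ginv0 a f (1 / x).
  by move=> x0; rewrite ginv0_gt0 // divr_gt0.
have xgE (x : R) : 0 < x ->
    x * (1 / (x * ginv0 a f (1 / x))) = (ginv0 a f (1 / x))^-1.
  by move=> x0; field; rewrite !lt0r_neq0 ?F0.
split=> [x x0|x y x0 xy|x y x0 xy].
- by rewrite divr_gt0 // mulr_gt0 // F0.
- have y0 : 0 < y by apply: lt_le_trans xy.
  rewrite !xgE // lef_pV2 ?posrE ?F0 //; apply: ginv0_nd => //.
  by rewrite !div1r lef_pV2.
have y0 : 0 < y by apply: lt_le_trans xy.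
have yx : y^-1 <= x^-1 by rewrite lef_pV2.
rewrite PhiB ?invr_gt0 //.
have := F0 _ x0; have := F0 _ y0; rewrite !div1r => Fy Fx.
have -> : (x * ginv0 a f x^-1)^-1 * (1 - x / y) =
    (x^-1 - y^-1) / ginv0 a f x^-1 by field; rewrite !lt0r_neq0.
have -> : (y * ginv0 a f y^-1)^-1 * (y / x - 1) =
    (x^-1 - y^-1) / ginv0 a f y^-1 by field; rewrite !lt0r_neq0.
by apply: Rintegral_ginv0V_bounds; rewrite ?invr_gt0.
Qed.

Lemma Phi_invP (R : realType) (a delta m : R) (f : R -> R) :
  nd_vanishing a f -> 0 < delta -> 0 < m ->
  (\forall x \near +oo, m <= 1 / (x * ginv0 a f (1 / x))) ->
  \forall s \near +oo, 0 < (Phi_inv a delta f s)^-1 /\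
    Phi a delta f ((Phi_inv a delta f s)^-1)^-1 = s.
Proof.
move=> af d0 m0 gm; have gG := log_primitive_Phi af d0.
near=> s.
have : exists2 x, delta^-1 <= x & s <= Phi a delta f x^-1.
  have /near_pinftyP[x0 x00 Hx0] := log_primitive_cvgy gG m0 gm s.
  exists (Num.max x0 delta^-1); first by rewrite le_max lexx orbT.
  by apply: Hx0; rewrite le_max lexx.
move=> [x dx sx].
have [||z z0 zs] := @log_primitive_IVT _ _ _ delta^-1 x s gG _ dx.
- by rewrite invr_gt0.
- rewrite sx andbT; near: s; apply: nbhs_pinfty_ge; rewrite num_real.
  by [].
(* On the image of [Phi], [Phi_inv] is a true right inverse with positive values; the default 0
   occurs only outside. *)
have sin : s \in [set Phi a delta f u | u in `]0, +oo[%classic].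
  by rewrite inE; exists z^-1 => //=; rewrite in_itv /= andbT invr_gt0.
have P0 : 0 < Phi_inv a delta f s.
  have : [set Phi_inv a delta f u | u in
      [set Phi a delta f u | u in `]0, +oo[%classic]] `<=` `]0, +oo[%classic.
    by apply: surjpinv_image_sub => u.
  move=> /(_ (Phi_inv a delta f s)); rewrite /= in_itv /= andbT; apply.
  by exists s => //; move: sin; rewrite inE.
split; first by rewrite invr_gt0.
by rewrite invrK; exact: (pinvK (fun=> 0)).
Unshelve. all: by end_near. Qed.

(** * Geometric growth, and the case [rho = 0] *)

(** [H] never drops below [m], so each step adds at least [(th - 1) * m], and [log_growth]
    applies. *)
Lemma cvgy_of_geometric_step (R : realType) (H : R -> R) (x0 mu th m : R) :
  0 < x0 -> 1 < mu -> 1 < th -> 0 < m ->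
  (forall x, x0 <= x -> 0 <= H x) ->
  (forall x, x0 <= x -> th * H x <= H (mu * x)) ->
  (forall x, x0 <= x <= mu * x0 -> m <= H x) ->
  forall K, \forall x \near +oo, K <= H x.
Proof.
move=> x00 mu1 th1 m0 H0 Hs Hm K.
have step x : x0 <= x -> H x + (th - 1) * H x <= H (mu * x).
  by move=> x0x; have := Hs _ x0x; lra.
have mH x : x0 <= x -> m <= H x.
  apply: (@ge_of_step _ _ _ mu) => // z x0z; apply: le_trans (step _ x0z).
  by rewrite lerDl mulr_ge0 ?H0 //; lra.
have [x x0x|//|C HC] := @log_growth _ H x0 mu m ((th - 1) * m) x00 mu1.
  apply: le_trans (step _ x0x); rewrite lerD2l ler_wpM2l ?mH //; lra.
have c0 : 0 < (th - 1) * m / ln mu.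
  by rewrite divr_gt0 ?mulr_gt0 ?ln_gt0 //; lra.
near=> x.
have Hx : (th - 1) * m / ln mu * ln x - C <= H x.
  by apply: HC; near: x; apply: nbhs_pinfty_ge; rewrite num_real.
have : K + C <= (th - 1) * m / ln mu * ln x by near: x; apply: ln_near_pinfty.
by lra.
Unshelve. all: by end_near. Qed.

(** Monotonicity of [u * g u] bounds [g x] by [X * g X / b]; the absolute values in the bound on the
    power cover both signs of [alpha]. *)
Lemma log_primitive_bounded (R : realType) (g G : R -> R) (b alpha X : R) :
  log_primitive g G -> 0 < b ->
  exists M, forall x, b <= x <= X -> x `^ alpha * g x <= M.
Proof.
move=> [g0 kg _] b0.
exists (expR (`|alpha| * (`|ln b| + `|ln X|)) * (X * g X / b)).
move=> x /andP[bx xX]; have x0 : 0 < x by apply: lt_le_trans bx.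
have X0 : 0 < X by apply: lt_le_trans xX.
apply: ler_pM; [exact: powR_ge0|exact/ltW/g0| |].
  rewrite /powR gt_eqF // ler_expR.
  apply: le_trans (ler_norm _) _; rewrite normrM ler_wpM2l //.
  have l1 : ln b <= ln x by rewrite ler_ln.
  have l2 : ln x <= ln X by rewrite ler_ln.
  rewrite ler_norml; apply/andP; split.
    have := ler_norm (- ln b); rewrite normrN.
    by have := normr_ge0 (ln X); lra.
  by have := ler_norm (ln X); have := normr_ge0 (ln b); lra.
rewrite ler_pdivlMr //; apply: le_trans (kg _ _ x0 xX).
by rewrite mulrC ler_wpM2r // ltW // g0.
Qed.

Lemma powR_gt1 (R : realType) (l r : R) : 1 < l -> 0 < r -> 1 < l `^ r.
Proof.
by move=> l1 r0; rewrite /powR gt_eqF ?expR_gt1 ?mulr_gt0 ?ln_gt0 //; lra.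
Qed.

Lemma RV_step (R : realType) (h : R -> R) (q l : R) :
  RV q h -> 0 < q -> 1 < l ->
  exists2 th, 1 < th & \forall x \near +oo, th * h x <= h (l * x).
Proof.
move=> [b [b0 h0 _ hl]] q0 l1; have l0 : 0 < l by lra.
have lq := powR_gt1 l1 q0.
(* Midway between 1 and the limit [l ^ q] of the ratio. *)
exists ((1 + l `^ q) / 2); first by lra.
near=> x.
have hx : 0 < h x.
  by apply: h0; near: x; apply: nbhs_pinfty_ge; rewrite num_real.
rewrite -ler_pdivlMr //; apply/ltW; near: x.
by apply: (cvgr_gt (l `^ q)); [exact: hl|lra].
Unshelve. all: by end_near. Qed.

(** A doubling of [x] multiplies [ln g] by at least [th > 1] but only adds [ln 2] to [ln x]. First
    [ln g] is shown to tend to infinity; then its increments exceed any multiple of [ln 2]. *)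
Lemma RV_ln_dominates (R : realType) (g G : R -> R) (q : R) :
  log_primitive g G -> RV q (fun x => ln (g x)) -> 0 < q ->
  forall N, \forall x \near +oo, N * ln x <= ln (g x).
Proof.
move=> [g0 kg _] hRV q0 N; have [b [b0 h0 _ _]] := hRV.
have two1 : 1 < 2 :> R by lra.
have [th th1 /near_pinftyP[x0 x00 Hx0]] := RV_step hRV q0 two1.
pose h x := ln (g x); pose z := Num.max x0 b.
have z0 : 0 < z by rewrite /z lt_max x00.
have hz x : z <= x -> 0 < h x.
  by rewrite /z ge_max => /andP[_ bx]; apply: h0.
have sz x : z <= x -> th * h x <= h (2 * x).
  by rewrite /z ge_max => /andP[x0x _]; apply: Hx0.
have hzz : 0 < h z by apply: hz.
(* [h + ln] is nondecreasing, so [h] loses at most [ln 2] on [[x1, 2 x1]]. *)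
have [x1 zx1 hx1] : exists2 x1, z <= x1 & ln 2 + 1 <= h x1.
  have grow n : z <= 2 ^+ n * z /\
      h z + n%:R * ((th - 1) * h z) <= h (2 ^+ n * z).
    elim: n => [|n [IH1 IH2]]; first by rewrite mul1r mul0r addr0.
    rewrite exprS -mulrA; split; first by lra.
    apply: le_trans (sz _ IH1).
    have n0 : 0 <= n%:R * ((th - 1) * h z).
      by rewrite !mulr_ge0 // ?ltW // subr_gt0.
    have hh : h z <= h (2 ^+ n * z) by lra.
    have : (th - 1) * h z <= (th - 1) * h (2 ^+ n * z).
      by rewrite ler_wpM2l //; lra.
    by rewrite -natr1; lra.
  have d0 : 0 < (th - 1) * h z by rewrite mulr_gt0 // subr_gt0.
  pose n := (Num.truncn ((ln 2 + 1) / ((th - 1) * h z))).+1.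
  have := grow n => -[]; exists (2 ^+ n * z) => //.
  have : ln 2 + 1 <= n%:R * ((th - 1) * h z).
    by rewrite -ler_pdivrMr //; apply/ltW/truncnS_gt.
  lra.
have x10 : 0 < x1 by lra.
have hy : forall K, \forall x \near +oo, K <= h x.
  apply: (@cvgy_of_geometric_step _ h x1 2 th 1) => //.
  - by move=> x x1x; apply/ltW/hz; lra.
  - by move=> x x1x; apply: sz; lra.
  move=> x /andP[x1x xx1]; have x0' : 0 < x by lra.
  have : ln (x1 * g x1) <= ln (x * g x).
    by rewrite ler_ln ?posrE ?mulr_gt0 ?g0 // kg.
  rewrite !lnM ?posrE ?g0 // -/(h x1) -/(h x).
  have : ln x <= ln (2 * x1) by rewrite ler_ln ?posrE //; lra.
  by rewrite lnM ?posrE //; lra.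
(* From here on each doubling adds at least [(N + 1) * ln 2] to [h]; the surplus [ln x] over
   [N * ln x] absorbs the constant [C]. *)
have /near_pinftyP[x2 x20 Hx2] := hy ((N + 1) * ln 2 / (th - 1)).
pose w := Num.max z x2.
have w0 : 0 < w by rewrite /w lt_max z0.
have [x|x /andP[+ _]|C HC] :=
  @log_growth _ h w 2 0 ((N + 1) * ln 2) w0 two1.
- rewrite /w ge_max => /andP[zx x2x]; apply: le_trans (sz _ zx).
  have := Hx2 _ x2x; rewrite ler_pdivrMr ?subr_gt0 //; lra.
- by rewrite /w ge_max => /andP[/hz/ltW].
have ln2 : ln 2 != 0 :> R by rewrite gt_eqF // ln_gt0.
rewrite mulfK // in HC.
near=> x; have : (N + 1) * ln x - C <= h x.
  by apply: HC; near: x; apply: nbhs_pinfty_ge; rewrite num_real.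
have : C <= 1 * ln x by near: x; apply: ln_near_pinfty.
by rewrite /h; lra.
Unshelve. all: by end_near. Qed.

Lemma ginvoo_equiv_rapid (R : realType) (g G p : R -> R) (b q alpha : R) :
  log_primitive g G -> 0 < b -> 0 < q -> RV q (fun x => ln (g x)) ->
  (\forall s \near +oo, 0 < (p s)^-1 /\ G (p s)^-1 = s) ->
  p ~_(pinfty_nbhs R)
    (fun s => 1 / ginvoo b (fun x => x `^ alpha * g x) s).
Proof.
move=> gG b0 q0 hRV Hp; have [g0 kg HG] := gG.
have hdom := RV_ln_dominates gG hRV q0.
have gt0 : \forall x \near +oo, 0 < x :> R.
  by apply: nbhs_pinfty_gt; rewrite num_real.
have g1 : \forall x \near +oo, 1 <= g x.
  have [c [c0 h0 _ _]] := hRV; apply/near_pinftyP; exists c => // x cx.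
  have x0 : 0 < x by lra.
  by rewrite -ler_ln ?posrE ?g0 // ln1 ltW // h0.
apply: (ginvoo_equiv gG b0 Hp).
- by move=> X; apply: (log_primitive_bounded _ _ gG).
- move=> l l1; have l0 : 0 < l by lra.
  (* One factor [mu] is spent on the growth of [ln g], the other on the increment of [G] from
     [mu * x] to [l * x]. *)
  pose mu := Num.sqrt l.
  have mu0 : 0 < mu by rewrite sqrtr_gt0.
  have mumu : l = mu * mu by rewrite -expr2 sqr_sqrtr // ltW.
  have mu1 : 1 < mu by nra.
  have c0 : 0 < 1 - mu^-1 by rewrite subr_gt0 invf_lt1.
  have [th th1 Hth] := RV_step hRV q0 mu1.
  have G0 : \forall x \near +oo, 0 <= G (mu * x).
    by apply: (near_pinfty_scale mu0 (log_primitive_cvgy gG ltr01 g1 0)).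
  near=> x; have x0 : 0 < x by near: x.
  have mx0 : 0 < mu * x by rewrite mulr_gt0.
  have /andP[+ _] := log_primitive_step gG mu1 mx0.
  rewrite mulrA -mumu.
  have : 0 <= G (mu * x) by near: x.
  suff : x `^ alpha * g x <= (1 - mu^-1) * g (mu * x) by lra.
  rewrite -ler_ln ?posrE ?mulr_gt0 ?powR_gt0 ?g0 //.
  rewrite !lnM ?posrE ?powR_gt0 ?g0 // ln_powR.
  have : th * ln (g x) <= ln (g (mu * x)) by near: x.
  (* The gain [(th - 1) * ln (g x)] covers [alpha * ln x] and one more [ln x], which absorbs
     [- ln (1 - mu^-1)]. *)
  have : (alpha + 1) / (th - 1) * ln x <= ln (g x) by near: x; apply: hdom.
  rewrite mulrAC ler_pdivrMr ?subr_gt0 //.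
  have : - ln (1 - mu^-1) <= 1 * ln x by near: x; apply: ln_near_pinfty.
  lra.
move=> l l1; have l0 : 0 < l by lra.
have [th th1 Hth] := RV_step hRV q0 l1.
near=> x; have x0 : 0 < x by near: x.
have x1 : 1 <= x by near: x; apply: nbhs_pinfty_ge; rewrite num_real.
have xG : G 1 <= x by near: x; apply: nbhs_pinfty_ge; rewrite num_real.
have gx1 : 1 <= g x by near: x.
have /andP[_] := HG 1 x ltr01 x1; rewrite divr1 => HGx.
have xg : x <= x * g x by rewrite ler_peMr // ltW.
have gx0 : 0 < g x by lra.
(* [G x <= G 1 + g x * (x - 1)], and [G 1 <= x <= x * g x]. *)
apply: (@le_trans _ _ (2 * (x * g x))); first by lra.
rewrite -ler_ln ?posrE ?mulr_gt0 ?powR_gt0 ?g0 ?mulr_gt0 //.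
rewrite lnM ?posrE ?mulr_gt0 // lnM ?posrE //.
rewrite lnM ?posrE ?powR_gt0 ?g0 ?mulr_gt0 // ln_powR lnM ?posrE //.
have : th * ln (g x) <= ln (g (l * x)) by near: x.
have : (2 - alpha) / (th - 1) * ln x <= ln (g x) by near: x; apply: hdom.
rewrite mulrAC ler_pdivrMr ?subr_gt0 //.
have : ln 2 - alpha * ln l <= 1 * ln x by near: x; apply: ln_near_pinfty.
lra.
Unshelve. all: by end_near. Qed.

(** * Discrete Karamata bounds, and the case [0 < rho < 1] *)

(** From [x] to [mu * x], [G] gains at most [(mu - 1) * g (mu * x)], while [A * g] gains at least
    [A * (1 - th^-1) * g (mu * x)]. *)
Lemma karamata_le (R : realType) (g G : R -> R) (r A : R) :
  log_primitive g G -> 0 < r -> r^-1 < A ->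
  (forall l th, 0 < l -> th < l `^ r ->
    \forall x \near +oo, th * g x <= g (l * x)) ->
  exists C, \forall x \near +oo, G x <= A * g x + C.
Proof.
move=> gG r0 rA gl; have [g0 _ _] := gG.
have A0 : 0 < A by apply: lt_trans rA; rewrite invr_gt0.
have Ar : 1 < A * r by rewrite -ltr_pdivrMr // div1r.
(* [t] solves [A * (1 - th^-1) = mu - 1] for the [mu] and [th] below, which
   makes [A * g - G] nondecreasing along [x -> mu * x]. *)
pose t := (A * r - 1) / (A * r + r).
have D0 : 0 < A * r + r by lra.
have t0 : 0 < t by rewrite divr_gt0 //; lra.
have t1 : t < 1 by rewrite ltr_pdivrMr //; lra.
have tE : t * (A * r + r) = A * r - 1 by rewrite divfK // gt_eqF.
pose mu := (1 - t)^-1.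
have mu1 : 1 < mu by rewrite invf_gt1; lra.
have mu0 : 0 < mu by lra.
have muE : mu * (1 - t) = 1 by rewrite mulVf // gt_eqF //; lra.
pose th := 1 + r * t.
have th1 : 1 < th by rewrite ltrDl mulr_gt0.
(* [1 + r * t < expR (r * t) <= mu ^ r], because [ln mu = - ln (1 - t) >= t]. *)
have thmu : th < mu `^ r.
  rewrite /powR gt_eqF //.
  have rt : r * t != 0 by exact: lt0r_neq0 (mulr_gt0 r0 t0).
  apply: lt_le_trans (expR_gt1Dx rt) _; rewrite ler_expR ler_pM2l //.
  rewrite /mu lnV ?posrE; last by lra.
  have := @le_ln1Dx _ (- t); lra.
have /near_pinftyP[x0 x00 Hx0] := gl mu th mu0 thmu.
exists (G (mu * x0)); apply/near_pinftyP; exists x0 => // x x0x.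
suff : - G (mu * x0) <= A * g x - G x by lra.
move: x x0x; apply: (@ge_of_step _ (fun x => A * g x - G x) _ mu) => // x.
  move=> x0x; have x' : 0 < x by lra.
  have /andP[_ +] := log_primitive_step gG mu1 x'.
  have := Hx0 _ x0x; move: (g0 _ (mulr_gt0 mu0 x')).
  move: (g (mu * x)) (g x) (G (mu * x)) (G x) => a b c d a0 ba cd.
  suff : (mu - 1) * a <= A * (a - b) by lra.
  have th0 : 0 < th by lra.
  have ba' : b <= a / th by rewrite ler_pdivlMr // mulrC.
  have : A * (a - a / th) <= A * (a - b) by rewrite ler_pM2l // lerD2l lerN2.
  apply: le_trans.
  rewrite -(ler_pM2r th0) -(ler_pM2r (_ : 0 < 1 - t)); last by lra.
  have -> : A * (a - a / th) * th * (1 - t) = a * (A * (th - 1) * (1 - t)).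
    by field; rewrite gt_eqF.
  have -> : (mu - 1) * a * th * (1 - t) = a * (th * (mu * (1 - t) - (1 - t))).
    by ring.
  rewrite muE ler_pM2l // /th.
  have -> : (1 + r * t) * (1 - (1 - t)) = t * (1 + r * t) by ring.
  have -> : A * (1 + r * t - 1) * (1 - t) = t * (A * r * (1 - t)) by ring.
  by rewrite ler_pM2l //; lra.
move=> /andP[x0x xx]; have x' : 0 < x by lra.
have := log_primitive_le gG x' xx; have := mulr_gt0 A0 (g0 _ x'); lra.
Qed.

(** From [x] to [mu * x], [G] gains at least [(1 - mu^-1) * g x], while [A * g] gains at most
    [A * (th - 1) * g x]. *)
Lemma karamata_ge (R : realType) (g G : R -> R) (r A : R) :
  log_primitive g G -> 0 < r -> 0 < A < r^-1 ->
  (forall l th, 0 < l -> l `^ r < th ->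
    \forall x \near +oo, g (l * x) <= th * g x) ->
  exists C, \forall x \near +oo, A * g x - C <= G x.
Proof.
move=> gG r0 /andP[A0 rA] gl; have [g0 kg _] := gG.
have Ar : A * r < 1 by rewrite -ltr_pdivlMr // div1r.
(* [t] solves [1 - mu^-1 = A * (th - 1)] for the [mu] and [th] below. *)
pose t := (1 - A * r) / (r + A * r).
have Ar0 : 0 < A * r by rewrite mulr_gt0.
have D0 : 0 < r + A * r by lra.
have t0 : 0 < t by rewrite divr_gt0 //; lra.
have tE : t * (r + A * r) = 1 - A * r by rewrite divfK // gt_eqF.
have tAr0 : 0 < t * (A * r) by rewrite mulr_gt0.
have rt1 : r * t < 1 by lra.
pose mu := 1 + t.
have mu1 : 1 < mu by rewrite ltrDl.
have mu0 : 0 < mu by lra.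
pose th := (1 - r * t)^-1.
have th0 : 0 < 1 - r * t by lra.
have thE : th * (1 - r * t) = 1 by rewrite mulVf // gt_eqF.
have rt0 : 0 < r * t by rewrite mulr_gt0.
(* [mu ^ r <= expR (r * t) < (1 - r * t)^-1]. *)
have thmu : mu `^ r < th.
  rewrite /powR gt_eqF //.
  have lmu : ln mu <= t by apply: le_ln1Dx; lra.
  apply: (@le_lt_trans _ _ (expR (r * t))).
    by rewrite ler_expR ler_pM2l.
  rewrite -[r * t]opprK expRN ltf_pV2 ?posrE ?expR_gt0 //.
  by apply: expR_gt1Dx; rewrite oppr_eq0 gt_eqF.
have /near_pinftyP[x0 x00 Hx0] := gl mu th mu0 thmu.
(* On [[x0, mu * x0]], monotonicity of [u * g u] gives [g x <= mu * g (mu * x0)]. *)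
exists (A * (mu * g (mu * x0)) - G x0).
apply/near_pinftyP; exists x0 => // x x0x.
suff : G x0 - A * (mu * g (mu * x0)) <= G x - A * g x by lra.
move: x x0x; apply: (@ge_of_step _ (fun x => G x - A * g x) _ mu) => // x.
  move=> x0x; have x' : 0 < x by lra.
  have /andP[+ _] := log_primitive_step gG mu1 x'.
  have := Hx0 _ x0x; move: (g0 _ x').
  move: (g (mu * x)) (g x) (G (mu * x)) (G x) => b a c d a0 ba cd.
  suff : A * (b - a) <= (1 - mu^-1) * a by lra.
  have : A * (b - a) <= A * (th * a - a) by rewrite ler_pM2l // lerD2r.
  move=> /le_trans; apply.
  rewrite -(ler_pM2r mu0) -(ler_pM2r th0).
  have -> : A * (th * a - a) * mu * (1 - r * t) =
      a * (A * mu * (th * (1 - r * t) - (1 - r * t))) by ring.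
  have -> : (1 - mu^-1) * a * mu * (1 - r * t) = a * ((mu - 1) * (1 - r * t)).
    by field; rewrite gt_eqF.
  rewrite thE ler_pM2l // /mu.
  have -> : A * (1 + t) * (1 - (1 - r * t)) = t * (A * r * (1 + t)) by ring.
  have -> : (1 + t - 1) * (1 - r * t) = t * (1 - r * t) by ring.
  by rewrite ler_pM2l //; lra.
move=> /andP[x0x xx]; have x' : 0 < x by lra.
have := log_primitive_le gG x00 x0x.
suff : A * g x <= A * (mu * g (mu * x0)) by lra.
rewrite ler_pM2l // -(ler_pM2l x00).
have := kg _ _ x' xx; rewrite mulrA [mu * x0]mulrC => xg.
apply: (le_trans _ xg).
by rewrite ler_wpM2r // ltW // g0.
Qed.

(** Doublings multiply [g] by at least [th > 1], and monotonicity of [u * g u] keeps [g] above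
    [g x0 / 2] on the first window. *)
Lemma regular_cvgy (R : realType) (g G : R -> R) (r : R) :
  log_primitive g G -> 0 < r ->
  (forall l th, 0 < l -> th < l `^ r ->
    \forall x \near +oo, th * g x <= g (l * x)) ->
  forall K, \forall x \near +oo, K <= g x.
Proof.
move=> [g0 kg _] r0 gge.
have two0 : 0 < 2 :> R by lra.
have two1 : 1 < 2 :> R by lra.
have th1 := powR_gt1 two1 r0; pose th : R := (1 + 2 `^ r) / 2.
have thr : th < 2 `^ r by rewrite /th; lra.
have /near_pinftyP[x0 x00 Hx0] := gge 2 th two0 thr.
apply: (@cvgy_of_geometric_step _ g x0 2 th (g x0 / 2)) => //.
- by rewrite /th; lra.
- by rewrite divr_gt0 // g0.
- by move=> x x0x; apply/ltW/g0; lra.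
move=> x /andP[x0x xx].
have := kg _ _ x00 x0x => /le_trans.
have : x * g x <= (2 * x0) * g x by rewrite ler_wpM2r // ltW // g0; lra.
by move=> /[swap]/[apply]; rewrite -mulrA [leRHS]mulrCA ler_pM2l //; lra.
Qed.

Lemma ginvoo_equiv_regular (R : realType) (g G p : R -> R) (b r : R) :
  log_primitive g G -> 0 < b -> 0 < r ->
  (forall l th, 0 < l -> l `^ r < th ->
    \forall x \near +oo, g (l * x) <= th * g x) ->
  (forall l th, 0 < l -> th < l `^ r ->
    \forall x \near +oo, th * g x <= g (l * x)) ->
  (\forall s \near +oo, 0 < (p s)^-1 /\ G (p s)^-1 = s) ->
  p ~_(pinfty_nbhs R) (fun s => 1 / ginvoo b g (r * s)).
Proof.
move=> gG b0 r0 gle gge Hp; have [g0 kg HG] := gG.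
have gy := regular_cvgy gG r0 gge.
(* The factor [r] moves from the argument to the function: [r * s < g x] iff [s < g x / r]. *)
have -> : (fun s => 1 / ginvoo b g (r * s)) =
    (fun s => 1 / ginvoo b (fun x => g x / r) s).
  apply/funext => s; congr (1 / inf _); apply/seteqP.
  by split=> x [bx sx]; split=> //; move: sx; rewrite ltr_pdivlMr // mulrC.
apply: (ginvoo_equiv gG b0 Hp).
- move=> X; have [M HM] := log_primitive_bounded 0 X gG b0.
  exists (M / r) => x /HM; rewrite powRr0 mul1r => gM.
  by rewrite ler_pM2r // invr_gt0.
- move=> l l1; have l0 : 0 < l by lra.
  have lr := powR_gt1 l1 r0; pose th := (1 + l `^ r) / 2.
  have th1 : 1 < th by rewrite /th; lra.
  (* Then [A * th] exceeds [r^-1] by [r^-1 * (th - 1) / 2]; this multiple of [g x] absorbs [C]. *)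
  pose A := r^-1 * ((th^-1 + 1) / 2).
  have r'0 : 0 < r^-1 by rewrite invr_gt0.
  have th'1 : 0 < th^-1 < 1 by rewrite invr_gt0 invf_lt1; lra.
  have AA : 0 < A < r^-1.
    by rewrite mulr_gt0 //= ?gtr_pMr //; lra.
  have Ath : A * th = r^-1 * ((1 + th) / 2).
    by rewrite /A; field; rewrite !gt_eqF //; lra.
  have [C HC] := karamata_ge gG r0 AA gle.
  have HC' := near_pinfty_scale l0 HC.
  have tl : th < l `^ r by rewrite /th; lra.
  have Hth := gge l th l0 tl.
  near=> x.
  have : A * g (l * x) - C <= G (l * x) by near: x.
  have : th * g x <= g (l * x) by near: x.
  have : C / (r^-1 * ((th - 1) / 2)) <= g x by near: x; apply: gy.
  rewrite ler_pdivrMr; last by rewrite mulr_gt0 //; lra.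
  move=> Cg thg.
  have : A * (th * g x) <= A * g (l * x) by rewrite ler_pM2l //; lra.
  rewrite mulrA Ath; lra.
move=> l l1; have l0 : 0 < l by lra.
have lr := powR_gt1 l1 r0; pose th := (1 + l `^ r) / 2.
have th1 : 1 < th by rewrite /th; lra.
(* Midway between [r^-1] and [r^-1 * th], again leaving room for [C]. *)
pose A := r^-1 * ((1 + th) / 2).
have r'0 : 0 < r^-1 by rewrite invr_gt0.
have rA : r^-1 < A by rewrite ltr_pMr //; lra.
have [C HC] := karamata_le gG r0 rA gge.
have tl : th < l `^ r by rewrite /th; lra.
have Hth := gge l th l0 tl.
near=> x.
have : G x <= A * g x + C by near: x.
have : th * g x <= g (l * x) by near: x.
have : C / (r^-1 * ((th - 1) / 2)) <= g x by near: x; apply: gy.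
rewrite ler_pdivrMr; last by rewrite mulr_gt0 //; lra.
move=> Cg thg.
have : r^-1 * (th * g x) <= r^-1 * g (l * x) by rewrite ler_pM2l.
rewrite /A; lra.
Unshelve. all: by end_near. Qed.

(** * Bounded and slowly varying [g], for the case [rho = 1] *)

Lemma inverse_exponential_bounds (R : realType) (g G p : R -> R) (m1 m2 : R) :
  log_primitive g G -> 0 < m1 < m2 ->
  (\forall x \near +oo, m1 <= g x <= m2) ->
  (\forall s \near +oo, 0 < (p s)^-1 /\ G (p s)^-1 = s) ->
  exists tau1 tau2 c1 c2 : R,
    [/\ 0 < tau1, 0 < tau2, 0 < c1, c1 < c2 & c2 < 1] /\
    \forall s \near +oo, tau1 * c1 `^ s <= p s <= tau2 * c2 `^ s.
Proof.
move=> gG /andP[m10 m12] /near_pinftyP[x0 x00 Hx0] Hp.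
have two1 : 1 < 2 :> R by lra.
have step x : x0 <= x -> m1 / 2 <= G (2 * x) - G x <= m2.
  move=> x0x; have x' : 0 < x by lra.
  have /andP[s1 s2] := log_primitive_step gG two1 x'.
  have /andP[h1 _] := Hx0 _ x0x.
  have /andP[_ h2] := Hx0 (2 * x) ltac:(lra).
  by apply/andP; split; lra.
have [x x0x|x /andP[x0x _]|C1 HC1] :=
  @log_growth _ G x0 2 (G x0) (m1 / 2) x00 two1.
- by have := step x x0x; lra.
- exact: log_primitive_le gG _ _.
have [x x0x|x /andP[x0x xx]|C2 HC2] :=
  @log_growth _ (fun x => - G x) x0 2 (- G (2 * x0)) (- m2) x00 two1.
- by have := step x x0x; lra.
- by rewrite lerN2; apply: log_primitive_le gG _ xx; lra.
have l20 : 0 < ln 2 :> R by rewrite ln_gt0.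
pose k1 := m1 / 2 / ln 2; pose k2 := m2 / ln 2.
have k10 : 0 < k1 by rewrite !divr_gt0.
have k12 : k1 < k2 by rewrite ltr_pM2r ?invr_gt0 //; lra.
have k20 : 0 < k2 by lra.
(* Read off from [k1 * ln x - C1 <= G x <= k2 * ln x + C2] at [x = (p s)^-1], where [G x = s] and
   [ln x = - ln (p s)]. *)
exists (expR (- (C1 / k1))), (expR (C2 / k2)).
exists (expR (- k1^-1)), (expR (- k2^-1)).
split.
  split; rewrite ?expR_gt0 // ?ltr_expR ?ltrN2 ?ltf_pV2 //.
  by rewrite expR_lt1 oppr_lt0 invr_gt0.
have Hy : \forall s \near +oo, x0 <= (p s)^-1.
  apply: (inverse_near gG Hp (P := fun y => x0 <= y)).
  by apply: nbhs_pinfty_ge; rewrite num_real.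
near=> s.
have [y0 Gy] : 0 < (p s)^-1 /\ G (p s)^-1 = s by near: s.
have xy : x0 <= (p s)^-1 by near: s.
have := HC1 _ xy; have := HC2 _ xy; rewrite Gy mulNr -/k1 -/k2.
have p0 : 0 < p s by rewrite -invr_gt0.
rewrite lnV ?posrE // mulNr => u1 u2.
have pE : p s = expR (ln (p s)) by rewrite lnK.
rewrite {1 2}pE /powR !gt_eqF ?expR_gt0 // !expRK -!expRD !ler_expR.
have e1 : k1 * (- (C1 / k1) + s * - k1^-1) = - C1 - s.
  by field; rewrite gt_eqF.
have e2 : k2 * (C2 / k2 + s * - k2^-1) = C2 - s.
  by field; rewrite gt_eqF.
rewrite -(ler_pM2l k10) e1 -[in X in _ && X](ler_pM2l k20) e2.
by apply/andP; split; lra.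
Unshelve. all: by end_near. Qed.

Lemma ginvoo_dominates_slow (R : realType) (g G p : R -> R) (b : R) :
  log_primitive g G -> 0 < b ->
  (forall l th, 0 < l -> th < 1 ->
    \forall x \near +oo, th * g x <= g (l * x)) ->
  (forall K, \forall x \near +oo, K <= g x) ->
  (\forall s \near +oo, 0 < (p s)^-1 /\ G (p s)^-1 = s) ->
  1 / (p s * ginvoo b g s) @[s --> +oo] --> 0.
Proof.
move=> gG b0 gl gy Hp; have [g0 _ _] := gG.
have two1 : 1 < 2 :> R by lra.
have gG_le l : 0 < l -> \forall x \near +oo, g x <= G (l * x).
  move=> l0.
  have l1 : 0 < l / 2 by lra.
  have l2 : 0 < l / 4 by lra.
  have l3 : 0 < l / 8 by lra.
  (* Each of the three doublings from [l / 8 * x] to [l * x] adds at least half of [3 / 4 * g x], in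
     total [9 / 8 * g x]. *)
  have th1 : 3 / 4 < 1 :> R by lra.
  have Gge0 : \forall x \near +oo, 0 <= G (l / 8 * x).
    by apply: (near_pinfty_scale l3 (log_primitive_cvgy gG ltr01 (gy 1) 0)).
  have G1 := gl _ _ l1 th1; have G2 := gl _ _ l2 th1; have G3 := gl _ _ l3 th1.
  near=> x; have x0 : 0 < x.
    by near: x; apply: nbhs_pinfty_gt; rewrite num_real.
  have /andP[+ _] := log_primitive_step gG two1 (mulr_gt0 l1 x0).
  have /andP[+ _] := log_primitive_step gG two1 (mulr_gt0 l2 x0).
  have /andP[+ _] := log_primitive_step gG two1 (mulr_gt0 l3 x0).
  have -> : 2 * (l / 2 * x) = l * x by field.
  have -> : 2 * (l / 4 * x) = l / 2 * x by field.
  have -> : 2 * (l / 8 * x) = l / 4 * x by field.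
  have : 3 / 4 * g x <= g (l / 2 * x) by near: x.
  have : 3 / 4 * g x <= g (l / 4 * x) by near: x.
  have : 3 / 4 * g x <= g (l / 8 * x) by near: x.
  have : 0 <= G (l / 8 * x) by near: x.
  have := g0 _ x0; lra.
have Hne : \forall s \near +oo, exists2 x, b <= x & s < g x.
  near=> s; have /near_pinftyP[x0 _ Hx0] := gy (s + 1).
  exists (Num.max x0 b); first by rewrite le_max lexx orbT.
  have : s + 1 <= g (Num.max x0 b) by apply: Hx0; rewrite le_max lexx.
  lra.
have gbd X : exists M, forall x, b <= x <= X -> g x <= M.
  have [M HM] := log_primitive_bounded 0 X gG b0.
  by exists M => x /HM; rewrite powRr0 mul1r.
apply/cvgrPdist_le => e e0.
have Hw := le_ginvoo gG b0 e0 Hp gbd Hne (gG_le e e0).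
near=> s.
have [y0 _] : 0 < (p s)^-1 /\ G (p s)^-1 = s by near: s.
have yw : (p s)^-1 / e <= ginvoo b g s by near: s.
have w0 : 0 < ginvoo b g s by apply: lt_le_trans yw; apply: divr_gt0.
have p0 : 0 < p s by rewrite -invr_gt0.
rewrite sub0r normrN ger0_norm; last by rewrite divr_ge0 // mulr_ge0 // ltW.
rewrite ler_pdivrMr ?mulr_gt0 // mulrCA -ler_pdivrMl // mulr1.
by rewrite mulrC -ler_pdivrMr.
Unshelve. all: by end_near. Qed.

(** * Transfer of the behaviour of [f] to [g] *)

(** [w] is the asymptotic factor of [f^-] when its argument is divided by [l]; the corresponding
    factor of [g] is [(l * w)^-1 = l ^ (1 / rho - 1)]. *)
Lemma powR_conjugate (R : realType) (rho l : R) :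
  0 < rho -> 0 < l ->
  exists2 w, 0 < w & w `^ rho = l^-1 /\ l * l `^ (1 / rho - 1) = w^-1.
Proof.
move=> r0 l0; exists (l `^ (- (1 / rho))); first exact: powR_gt0.
split.
  by rewrite -powRrM mulNr divfK ?lt0r_neq0 // powRN powRr1 // ltW.
rewrite -powRN opprK -{1}[l]powRr1 ?ltW // -powRD.
  by congr (_ `^ _); ring.
by rewrite (gt_eqF l0) implybT.
Qed.

Lemma ginv0_kernel_le (R : realType) (a rho : R) (f : R -> R) (l th : R) :
  nd_vanishing a f -> RV0_on a rho f -> 0 < rho -> 0 < l ->
  l `^ (1 / rho - 1) < th ->
  \forall x \near +oo, 1 / (l * x * ginv0 a f (1 / (l * x))) <=
    th * (1 / (x * ginv0 a f (1 / x))).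
Proof.
move=> af frv r0 l0 lth; have [w w0 [wr lw]] := powR_conjugate r0 l0.
have th0 : 0 < th by apply: le_lt_trans lth; exact: powR_ge0.
have lth0 : 0 < l * th by rewrite mulr_gt0.
(* The goal amounts to [nu * f^-(1/x) <= f^-(1/(l x))]. The hypothesis on [th] says [nu < w], and
   the midpoint supplies the gap for [ginv0_scale_ge]. *)
pose nu := (l * th)^-1.
have nuw : nu < w by rewrite -[w]invrK ltf_pV2 ?posrE ?invr_gt0 // -lw ltr_pM2l.
have nu0 : 0 < nu by rewrite invr_gt0.
have mid : ((nu + w) / 2) `^ rho < l^-1.
  by rewrite -wr gt0_ltr_powR // ?nnegrE; lra.
have nul : 0 < nu < (nu + w) / 2 by lra.
have H := ginv0_scale_ge af frv nul mid.
near=> x; have x0 : 0 < x.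
  by near: x; apply: nbhs_pinfty_gt; rewrite num_real.
have : nu * ginv0 a f x^-1 <= ginv0 a f (l^-1 * x^-1) by near: x.
have F0 : 0 < ginv0 a f x^-1 by rewrite ginv0_gt0 ?invr_gt0.
have F0' : 0 < ginv0 a f (l^-1 * x^-1) by rewrite ginv0_gt0 ?mulr_gt0 ?invr_gt0.
rewrite [1 / (l * x)]div1r [(l * x)^-1]invfM !div1r.
move: (ginv0 a f x^-1) (ginv0 a f (l^-1 * x^-1)) F0 F0'.
move=> u v u0 v0 uv.
rewrite -[th]invrK -invfM lef_pV2 ?posrE ?mulr_gt0 ?invr_gt0 //.
have -> : th^-1 * (x * u) = l * x * (nu * u).
  by rewrite /nu; field; rewrite !gt_eqF.
by rewrite ler_pM2l // mulr_gt0.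
Unshelve. all: by end_near. Qed.

Lemma ginv0_kernel_ge (R : realType) (a rho : R) (f : R -> R) (l th : R) :
  nd_vanishing a f -> RV0_on a rho f -> 0 < rho -> 0 < l ->
  th < l `^ (1 / rho - 1) ->
  \forall x \near +oo, th * (1 / (x * ginv0 a f (1 / x))) <=
    1 / (l * x * ginv0 a f (1 / (l * x))).
Proof.
move=> af frv r0 l0 lth; have [w w0 [wr lw]] := powR_conjugate r0 l0.
have [th0|th0] := leP th 0.
  near=> x; have x0 : 0 < x.
    by near: x; apply: nbhs_pinfty_gt; rewrite num_real.
  apply: (@le_trans _ _ 0).
    by rewrite mulr_le0_ge0 // divr_ge0 // mulr_ge0 ?ltW // ginv0_gt0 ?divr_gt0.
  by rewrite divr_ge0 // ltW // !mulr_gt0 ?ginv0_gt0 ?divr_gt0 ?mulr_gt0.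
have lth0 : 0 < l * th by rewrite mulr_gt0.
pose nu := (l * th)^-1.
have nuw : w < nu.
  by rewrite -[w]invrK ltf_pV2 ?posrE ?invr_gt0 // -lw ltr_pM2l.
have mid : l^-1 < ((nu + w) / 2) `^ rho.
  by rewrite -wr gt0_ltr_powR // ?nnegrE; lra.
have nul : 0 < (nu + w) / 2 < nu by lra.
have H := ginv0_scale_le af frv nul mid.
near=> x; have x0 : 0 < x.
  by near: x; apply: nbhs_pinfty_gt; rewrite num_real.
have : ginv0 a f (l^-1 * x^-1) <= nu * ginv0 a f x^-1 by near: x.
have F0 : 0 < ginv0 a f x^-1 by rewrite ginv0_gt0 ?invr_gt0.
have F0' : 0 < ginv0 a f (l^-1 * x^-1) by rewrite ginv0_gt0 ?mulr_gt0 ?invr_gt0.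
rewrite [1 / (l * x)]div1r [(l * x)^-1]invfM !div1r.
move: (ginv0 a f x^-1) (ginv0 a f (l^-1 * x^-1)) F0 F0'.
move=> u v u0 v0 uv.
rewrite -[th]invrK -invfM lef_pV2 ?posrE ?mulr_gt0 ?invr_gt0 //.
have -> : th^-1 * (x * u) = l * x * (nu * u).
  by rewrite /nu; field; rewrite !gt_eqF.
by rewrite ler_pM2l // mulr_gt0.
Unshelve. all: by end_near. Qed.

(** The hypothesis is used at [F / 2] with [F = f^-(1/x)]: there [f < 1/x], which need not hold at
    [F] itself. This costs the factor 2. *)
Lemma ginv0_kernel_ge_of_le (R : realType) (a c : R) (f : R -> R) :
  nd_vanishing a f -> 0 < c -> (\forall t \near 0^'+, t <= c * f t) ->
  \forall x \near +oo, (2 * c)^-1 <= 1 / (x * ginv0 a f (1 / x)).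
Proof.
move=> af c0 /near_at_right0P[d d0 Hd].
near=> x; have x0 : 0 < x.
  by near: x; apply: nbhs_pinfty_gt; rewrite num_real.
have F0 : 0 < ginv0 a f x^-1 by rewrite ginv0_gt0 ?invr_gt0.
have Fd : ginv0 a f x^-1 <= d by near: x; apply: ginv0_small.
rewrite !div1r lef_pV2 ?posrE ?mulr_gt0 //.
move: F0 Fd; set F := ginv0 a f x^-1 => F0 Fd.
have fF : f (F / 2) < x^-1.
  by apply: (f_lt_ginv0 af); rewrite ?invr_gt0 // -/F; lra.
have := Hd (F / 2) ltac:(lra).
have : c * f (F / 2) < c * x^-1 by rewrite ltr_pM2l.
move=> cf Fc; have : F <= 2 * c / x by lra.
by rewrite ler_pdivlMr // mulrC.
Unshelve. all: by end_near. Qed.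

(** Symmetrically, [f >= 1/x] at [2 * F]. *)
Lemma ginv0_kernel_le_of_ge (R : realType) (a c : R) (f : R -> R) :
  nd_vanishing a f -> 0 < c -> (\forall t \near 0^'+, f t <= c * t) ->
  \forall x \near +oo, 1 / (x * ginv0 a f (1 / x)) <= 2 * c.
Proof.
move=> af c0 /near_at_right0P[d d0 Hd]; have [a0 _ _ _] := af.
pose e := Num.min d a / 3.
have e0 : 0 < Num.min d a by rewrite lt_min d0.
have e'0 : 0 < e by rewrite divr_gt0.
near=> x; have x0 : 0 < x.
  by near: x; apply: nbhs_pinfty_gt; rewrite num_real.
have F0 : 0 < ginv0 a f x^-1 by rewrite ginv0_gt0 ?invr_gt0.
have Fe : ginv0 a f x^-1 <= e by near: x; apply: ginv0_small.
rewrite !div1r; move: F0 Fe; set F := ginv0 a f x^-1 => F0 Fe.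
have ed : Num.min d a <= d by rewrite ge_min lexx.
have ea : Num.min d a <= a by rewrite ge_min lexx orbT.
rewrite /e in Fe.
have fF : x^-1 <= f (2 * F) by apply: (@le_f_ginv0 _ a); rewrite -/F; lra.
have := Hd (2 * F) ltac:(lra) => f2.
have : x^-1 <= (2 * c) * F by lra.
by rewrite invfM -ler_pdivrMr.
Unshelve. all: by end_near. Qed.

Theorem theorem3p14 (R : realType) (a rho delta : R) (f : R -> R)
    (ha : 0 < a)
    (f_pos : forall x, 0 < x <= a -> 0 < f x)
    (rho_ge0 : 0 <= rho) (rho_le1 : rho <= 1)
    (f_RV : RV0_on a rho f)
    (f_nd : forall x y, 0 < x -> x <= y -> y <= a -> f x <= f y)
    (f_lim : f x @[x --> 0^'+] --> 0)
    (hdelta : 0 < delta) :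
  let b := 1 / delta in
  let g := fun x => 1 / (x * ginv0 a f (1 / x)) in
  let Phi_inv_f := Phi_inv a delta f in
  [/\ locally_bounded_on `[b, +oo[ g,
      rho = 0 ->
        forall q : R, 0 < q -> RV q (fun x => ln (g x)) ->
        forall alpha : R,
          Phi_inv_f ~_(pinfty_nbhs R)
            (fun s => 1 / ginvoo b (fun x => x `^ alpha * g x) s),
      0 < rho < 1 ->
        Phi_inv_f ~_(pinfty_nbhs R)
          (fun s => 1 / ginvoo b g ((1 / rho - 1) * s)) &
      rho = 1 ->
        (equiv_upto_cst (at_right_filter_on 0) f id ->
         exists tau1 tau2 c1 c2 : R,
           [/\ 0 < tau1, 0 < tau2, 0 < c1, c1 < c2 & c2 < 1] /\
           \forall s \near +oo,
             tau1 * c1 `^ s <= Phi_inv_f s <= tau2 * c2 `^ s) /\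
        (id =o_ (at_right 0) f ->
         1 / (Phi_inv_f s * ginvoo b g s) @[s --> +oo] --> 0)].
Proof.
move=> b g p; have af : nd_vanishing a f by split.
have b0 : 0 < b by rewrite divr_gt0.
have gG : log_primitive g (fun x => Phi a delta f x^-1).
  exact: log_primitive_Phi.
have Hp m : 0 < m -> (\forall x \near +oo, m <= g x) ->
    \forall s \near +oo, 0 < (p s)^-1 /\ Phi a delta f ((p s)^-1)^-1 = s.
  by move=> m0; apply: Phi_invP.
have [g0 kg _] := gG.
split.
- move=> K /compact_bounded[M [_ HM]] Kb.
  have [N HN] := log_primitive_bounded 0 (M + 1) gG b0.
  exists N; split; rewrite ?num_real // => N' NN' x /= Kx.
  have := Kb _ Kx; rewrite /= in_itv /= andbT => bx.
  have x0 : 0 < x by lra.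
  rewrite ger0_norm; last exact/ltW/g0.
  apply: le_trans (ltW NN'); have := HN x; rewrite powRr0 mul1r; apply.
  rewrite bx /=; apply: le_trans (ler_norm x) _; apply: HM Kx.
  by rewrite ltrDl.
- move=> _ q q0 hRV alpha; apply: (ginvoo_equiv_rapid _ gG b0 q0 hRV).
  (* Regular variation of [ln g] includes its eventual positivity, so [g >= 1] eventually. *)
  have [c [c0 h0 _ _]] := hRV; apply: (Hp 1) => //.
  apply/near_pinftyP; exists c => // x cx.
  have x0 : 0 < x by lra.
  by rewrite -ler_ln ?posrE ?g0 // ln1 ltW // h0.
- move=> /andP[r0 r1].
  have r'0 : 0 < 1 / rho - 1 by rewrite subr_gt0 ltr_pdivlMr // mul1r.
  have gle l th : 0 < l -> l `^ (1 / rho - 1) < th ->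
      \forall x \near +oo, g (l * x) <= th * g x.
    exact: ginv0_kernel_le.
  have gge l th : 0 < l -> th < l `^ (1 / rho - 1) ->
      \forall x \near +oo, th * g x <= g (l * x).
    exact: ginv0_kernel_ge.
  apply: (ginvoo_equiv_regular gG b0 r'0 gle gge).
  exact: Hp ltr01 (regular_cvgy gG r'0 gge 1).
move=> r1; split.
- case=> mu mu0 /eqoP fmu.
  (* Half of [mu] as tolerance keeps [f t / t] between [mu / 2] and [2 * mu]. *)
  have near_f : \forall t \near 0^'+, `|f t - mu * t| <= mu / 2 * `|t|.
    by apply: fmu; lra.
  have near0 : \forall t \near 0^'+, 0 < t :> R by apply: nbhs_right_gt.
  have lo : \forall t \near 0^'+, t <= (2 / mu) * f t.
    near=> t; have t0 : 0 < t by near: t.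
    have : `|f t - mu * t| <= mu / 2 * `|t| by near: t.
    rewrite (gtr0_norm t0) ler_norml => /andP[ft _].
    rewrite mulrAC ler_pdivlMr //; lra.
  have hi : \forall t \near 0^'+, f t <= (2 * mu) * t.
    near=> t; have t0 : 0 < t by near: t.
    have mt0 : 0 < mu * t by rewrite mulr_gt0.
    have : `|f t - mu * t| <= mu / 2 * `|t| by near: t.
    by rewrite (gtr0_norm t0) ler_norml => /andP[_ ft]; lra.
  have k10 : 0 < 2 / mu by rewrite divr_gt0.
  have k20 : 0 < 2 * mu by rewrite mulr_gt0.
  have glo := ginv0_kernel_ge_of_le af k10 lo.
  have ghi := ginv0_kernel_le_of_ge af k20 hi.
  have m10 : 0 < (2 * (2 / mu))^-1 by rewrite invr_gt0 mulr_gt0.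
  apply: (inverse_exponential_bounds gG (m1 := (2 * (2 / mu))^-1)
    (m2 := 2 * (2 * mu))).
  + have -> : (2 * (2 / mu))^-1 = mu / 4 by field; rewrite gt_eqF.
    by apply/andP; split; lra.
  + by near=> x; apply/andP; split; near: x.
  exact: Hp glo.
move=> /eqoP fo.
have gy K : \forall x \near +oo, K <= g x.
  (* Chosen so that the resulting lower bound [(2 * c)^-1] for [g] is [Num.max K 1]; the maximum
     keeps [c] positive. *)
  pose c := (2 * Num.max K 1)^-1.
  have K0 : 0 < Num.max K 1 by rewrite lt_max ltr01 orbT.
  have c0 : 0 < c by rewrite invr_gt0 mulr_gt0.
  have lo : \forall t \near 0^'+, t <= c * f t.
    near=> t; have t0 : 0 < t by near: t; apply: nbhs_right_gt.
    have ta : t <= a by near: t; apply: nbhs_right_le.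
    have ft0 : 0 < f t by apply: f_pos; rewrite t0.
    have : `|t| <= c * `|f t| by near: t; apply: fo.
    by rewrite !gtr0_norm.
  have glo := ginv0_kernel_ge_of_le af c0 lo.
  near=> x; have : (2 * c)^-1 <= g x by near: x.
  have -> : (2 * c)^-1 = Num.max K 1 by rewrite /c; field; rewrite gt_eqF.
  by rewrite ge_max => /andP[].
apply: (ginvoo_dominates_slow gG b0 _ gy (Hp 1 ltr01 (gy 1))) => l th l0 th1.
(* For [rho = 1] the index [1 / rho - 1] of [g] is 0, so the limiting ratio is 1. *)
by apply: (ginv0_kernel_ge af f_RV _ l0); rewrite r1 ?divr1 ?subrr ?powRr0.
Unshelve. all: by end_near. Qed.
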